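(* Let $P$ be a T-polytope of dimension $D=2d$ and let $v$ be any vertex of $P$. For each $t$, the number of faces of $P$ with exactly $t$ vertices that contain $v$ depends only on $D$ and $t$ (not on $P$ or $v$), and it equals the number of faces with $t$ vertices containing a given vertex of the cyclic polytope of dimension $D$ with $D+4$ vertices.
   Context: A convex polytope in $\mathbb{R}^{2d}$ is neighborly if every $d$ of its vertices form the vertex set of a face. The cyclic polytope of dimension $D$ with $n$ vertices is the convex hull of $n$ distinct points on the moment curve $t\mapsto(t,t^2,\dots,t^D)$ in $\mathbb{R}^D$. Gale diagrams: for a point set $X^*=\{x_1,\dots,x_N\}$ affinely spanning $\mathbb{R}^D$, take a basis of $\{\lambda\in\mathbb{R}^N:\sum\lambda_ix_i=0,\sum\lambda_i=0\}$ as rows of a matrix; its columns $\bar x_i\in\mathbb{R}^{N-D-1}$ form the vector Gale diagram. An affine Gale diagram is obtained by choosing an affine hyperplane $e$ not through $0$ and not parallel to any $\bar x_i$, and intersecting each line $\mathbb{R}\bar x_i$ with $e$, coloring the point black if it is a positive multiple of $\bar x_i$ and white otherwise. A T-diagram is an affine Gale diagram $X$ of the vertex set of a neighborly polytope in $\mathbb{R}^{2d}$ ($d\ge 1$) with $2d+4$ vertices such that $X$ has exactly $d+3$ black points and they are in convex position; such a polytope is called a T-polytope. *)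

(* Defs.v *)
From mathcomp Require Import all_boot all_order all_algebra.
From mathcomp Require Import all_classical reals convex.

Set Implicit Arguments.
Unset Strict Implicit.
Unset Printing Implicit Defensive.

Import Order.TTheory GRing.Theory Num.Theory.

Local Open Scope classical_set_scope.
Local Open Scope card_scope.
Local Open Scope ring_scope.

(* Points of R^n are row vectors; a linear functional is given by a column
   vector [a] and maps [y] to [(y *m a) 0 0]. *)

Definition convex_hull (R : realType) (n : nat) (A : set 'rV[R]_n) :
  set 'rV[R]_n := smallest (@convex_set R 'rV[R]_n) A.

Definition is_polytope (R : realType) (n : nat) (P : set 'rV[R]_n) : Prop :=
  exists s : seq 'rV[R]_n, P = convex_hull [set` s].

(* The improper faces are included: a = 0 gives P itself (b = 0) and the empty
   face (b = 1). *)
Definition is_face (R : realType) (n : nat) (P F : set 'rV[R]_n) : Prop :=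
  exists (a : 'cV[R]_n) (b : R),
    (forall y, P y -> (y *m a) 0 0 <= b) /\
    F = [set y | P y /\ (y *m a) 0 0 = b].

Definition vertices (R : realType) (n : nat) (P : set 'rV[R]_n) :
  set 'rV[R]_n := [set v | is_face P [set v]].

Definition faces_at (R : realType) (n : nat) (P : set 'rV[R]_n)
    (v : 'rV[R]_n) (t : nat) : set (set 'rV[R]_n) :=
  [set F | is_face P F /\ F v /\ vertices F #= `I_t].

Definition neighborly (R : realType) (d : nat) (P : set 'rV[R]_(2 * d)) :
  Prop :=
  forall S : set 'rV[R]_(2 * d), S `<=` vertices P -> S #= `I_d ->
    exists F, is_face P F /\ vertices F = S.

Definition moment_curve (R : realType) (D : nat) (t : R) : 'rV[R]_D :=
  \row_(j < D) t ^+ j.+1.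

Definition is_cyclic_polytope (R : realType) (D n : nat)
    (P : set 'rV[R]_D) : Prop :=
  exists t : 'I_n -> R, injective t /\
    P = convex_hull (range (fun i => moment_curve D (t i))).

Definition affinely_spanning (R : realType) (D N : nat)
    (x : 'I_N -> 'rV[R]_D) : Prop :=
  forall y : 'rV[R]_D, exists l : 'I_N -> R,
    \sum_i l i = 1 /\ \sum_i l i *: x i = y.

(* The rows of G form a basis of the space of affine dependences of x; the
   vector Gale diagram consists of the columns of G.  If x affinely spans R^D,
   this forces k = N - D - 1. *)
Definition is_gale_matrix (R : realType) (D N k : nat)
    (x : 'I_N -> 'rV[R]_D) (G : 'M[R]_(k, N)) : Prop :=
  row_free G /\
  forall l : 'rV[R]_N,
    (l <= G)%MS <-> \sum_i l 0 i *: x i = 0 /\ \sum_i l 0 i = 0.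

(* e = {y | c *m y = b} is an affine hyperplane of R^k that misses the origin
   and is parallel to no Gale vector; p i is the point where e meets the line
   spanned by the i-th Gale vector, and [black] is the set of indices of black
   points, all other points being white. *)
Definition is_affine_gale_diagram (R : realType) (D N k : nat)
    (x : 'I_N -> 'rV[R]_D) (p : 'I_N -> 'cV[R]_k) (black : {set 'I_N}) : Prop :=
  affinely_spanning x /\
  exists (G : 'M[R]_(k, N)) (c : 'rV[R]_k) (b : R),
    [/\ is_gale_matrix x G, c != 0, b != 0,
        (forall i, (c *m col i G) 0 0 != 0) &
        forall i, exists m : R,
          [/\ p i = m *: col i G, (c *m p i) 0 0 = b &
              (i \in black) = (0 < m)]].

Definition convex_position (R : realType) (k N : nat) (p : 'I_N -> 'cV[R]_k)
    (A : {set 'I_N}) : Prop :=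
  forall i, i \in A ->
    ~ smallest (@convex_set R 'cV[R]_k) (p @` [set j | j \in A /\ j != i]) (p i).

(* Here N = 2d + 4 and D = 2d, so the Gale diagram lives in R^3. *)
Definition is_T_diagram (R : realType) (d : nat)
    (x : 'I_(2 * d + 4) -> 'rV[R]_(2 * d)) (p : 'I_(2 * d + 4) -> 'cV[R]_3)
    (black : {set 'I_(2 * d + 4)}) : Prop :=
  [/\ is_affine_gale_diagram x p black, #|black| = (d + 3)%N &
      convex_position p black].

Definition is_T_polytope (R : realType) (d : nat) (P : set 'rV[R]_(2 * d)) :
  Prop :=
  [/\ (1 <= d)%N, is_polytope P, neighborly P &
      exists x : 'I_(2 * d + 4) -> 'rV[R]_(2 * d),
        [/\ injective x, vertices P = range x &
            exists (p : 'I_(2 * d + 4) -> 'cV[R]_3)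
                   (black : {set 'I_(2 * d + 4)}), is_T_diagram x p black]].

Arguments is_cyclic_polytope {R D} n P.
Arguments is_T_polytope {R} d P.
Arguments neighborly {R} d P.

(* Main.v *)
(* The theorem holds for every neighborly 2d-polytope with 2d + 4 vertices x_i.
   Let W be the space of affine dependences of the x_i, which has dimension 3.
   Neighborliness forces every nonzero w in W to have at least d + 1 positive and
   at least d + 1 negative entries, hence at most two zeros.  By Stiemke's lemma
   a proper subset Z of the vertices spans a face iff no w in W is positive on the
   complement S of Z; so one has to count the "pointed" sets S avoiding v, i.e.
   those on which some w is positive.  The sign vectors of W on the vertices other
   than v are the cells of a plane arrangement, and Euler's relation for the cells
   contained in an open convex cone gives, for each S,
     sum over the sign vectors that are positive on S of (-1)^(number of zeros)
       = 1 if S is pointed, and 0 otherwise.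
   Summing over the S of size s, the number of pointed sets of size s is a signed
   sum of binomials C(p, s), where p is the number of positive entries of a sign
   vector.  For w != 0 only p = d, ..., d + 3 occur, so the values for s = 0, ..., 3
   determine all the others; and these values are known, because every set of at
   most three elements is pointed. *)

Require Import Defs.
From mathcomp Require Import all_boot all_order all_algebra.
From mathcomp Require Import all_classical reals convex.
From mathcomp Require Import interval_inference fintype finset zify ring lra.

Set Implicit Arguments.
Unset Strict Implicit.
Unset Printing Implicit Defensive.

Import Order.TTheory GRing.Theory Num.Theory.

Local Open Scope ring_scope.

(** * Finite subsets, binomial coefficients and integer interpolation *)

Lemma subset_of_card (T : finType) (A C : {set T}) (k : nat) :
  A \subset C -> (#|A| <= k <= #|C|)%N ->
  exists D : {set T}, [/\ A \subset D, D \subset C & #|D| = k].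
Proof.
move=> sAC /andP[]; elim: k => [|k IH] Ak kC.
  by exists A; split=> //; apply/eqP; rewrite -leqn0.
have [Ak'|] := leqP #|A| k; last by move=> kA; exists A; split=> //; lia.
have [D [sAD sDC Dk]] := IH Ak' (ltnW kC).
have /set0Pn[x /setDP[xC xD]] : C :\: D != set0.
  rewrite -card_gt0 cardsD (setIidPr sDC); lia.
exists (x |: D); split; rewrite ?cardsU1 ?xD ?Dk //.
  exact: subset_trans sAD (subsetU1 _ _).
by rewrite subUset sub1set xC.
Qed.

(** Vandermonde expands ['C(d + p, k)] in the ['C(p, i)] by a unitriangular integer matrix free of
    [p]; induction on [k] inverts it. *)
Lemma binomial_shift (d k : nat) : exists c : nat -> int, forall p : nat,
  ('C(p, k))%:Z = \sum_(j < k.+1) c j * ('C(d + p, j))%:Z.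
Proof.
elim/ltn_ind: k => k IH.
have [c cP] : exists c : nat -> nat -> int, forall i, (i < k)%N -> forall p : nat,
    ('C(p, i))%:Z = \sum_(j < k) c i j * ('C(d + p, j))%:Z.
  have : forall i, exists c : nat -> int, (i < k)%N -> forall p : nat,
      ('C(p, i))%:Z = \sum_(j < k) c j * ('C(d + p, j))%:Z.
    move=> i; have [ik|ki] := ltnP i k; last by exists (fun=> 0).
    have [c cP] := IH i ik; exists (fun j => if (j < i.+1)%N then c j else 0).
    move=> _ p; rewrite cP (big_ord_widen k (fun j => c j * ('C(d + p, j))%:Z)) //.
    by rewrite big_mkcond; apply: eq_bigr => j _; case: ifP; rewrite ?mul0r.
  by move=> /choice[c cP]; exists c.
(* Vandermonde solved for its top term [i = k], the lower ['C(p, i)] being replaced by their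
   expansions. *)
exists (fun j => if j == k then 1 else - \sum_(i < k) ('C(d, k - i))%:Z * c i j).
move=> p; rewrite big_ord_recr /= eqxx mul1r.
have -> : ('C(d + p, k))%:Z =
    \sum_(i < k) ('C(d, k - i))%:Z * ('C(p, i))%:Z + ('C(p, k))%:Z.
  rewrite addnC -(binomial.Vandermonde p d k) -[LHS]natz natr_sum big_ord_recr /=.
  rewrite subnn bin0 muln1 natz; congr (_ + _).
  by apply: eq_bigr => i _; rewrite natz PoszM mulrC.
rewrite addrA [X in X + _](_ : _ = 0) ?add0r //.
apply/eqP; rewrite addrC addr_eq0; apply/eqP.
rewrite (eq_bigr (fun i : 'I_k => \sum_(j < k)
    ('C(d, k - i))%:Z * (c i j * ('C(d + p, j))%:Z))); last first.
  by move=> i _; rewrite (cP i _ p) // mulr_sumr.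
rewrite exchange_big -sumrN; apply: eq_bigr => j _ /=.
rewrite (ltn_eqF (ltn_ord j)) mulNr opprK mulr_suml.
by apply: eq_bigr => i _; rewrite mulrA.
Qed.

(** Interpolation at [d, ..., d + r] without division. In the Vandermonde expansion into the
    ['C(p, i)], the terms with [i > r] vanish because [p <= r]; [binomial_shift] then turns the
    remaining ones back into binomials of [d + p]. *)
Lemma binomial_interpolation (r d s : nat) : exists c : nat -> int,
  forall p : nat, (p <= r)%N ->
  ('C(d + p, s))%:Z = \sum_(k < r.+1) c k * ('C(d + p, k))%:Z.
Proof.
have /choice[c cP] : forall i, exists c : nat -> int, (i < r.+1)%N -> forall p : nat,
      ('C(p, i))%:Z = \sum_(j < r.+1) c j * ('C(d + p, j))%:Z.
  move=> i; have [ik|ki] := ltnP i r.+1; last by exists (fun=> 0).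
  have [c cP] := binomial_shift d i; exists (fun j => if (j < i.+1)%N then c j else 0).
  move=> _ p; rewrite cP (big_ord_widen r.+1 (fun j => c j * ('C(d + p, j))%:Z)) //.
  by rewrite big_mkcond; apply: eq_bigr => j _; case: ifP; rewrite ?mul0r.
exists (fun k => \sum_(i < r.+1 | (i <= s)%N) ('C(d, s - i))%:Z * c i k) => p pr.
have -> : ('C(d + p, s))%:Z =
    \sum_(i < r.+1 | (i <= s)%N) ('C(d, s - i))%:Z * ('C(p, i))%:Z.
  (* Terms beyond [minn p s] vanish, so stopping at [r] or at [s] gives the same sum. The guard is
     needed because [s - i] is truncated at 0. *)
  pose F i := if (i <= s)%N then ('C(d, s - i))%:Z * ('C(p, i))%:Z else 0.
  have FE (k : nat) : (minn p s <= k)%N ->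
      \sum_(i < k.+1) F i = \sum_(i < (minn p s).+1) F i.
    move=> le; rewrite [RHS](big_ord_widen k.+1 F) ?ltnS // [RHS]big_mkcond.
    apply: eq_bigr => i _; case: ifP => // /negbT; rewrite -leqNgt => ki.
    by rewrite /F; case: leqP => // is_; rewrite (@bin_small p) ?mulr0 //; lia.
  rewrite big_mkcond (FE r) -?(FE s); try lia.
  rewrite addnC -(binomial.Vandermonde p d s) -natz natr_sum; apply: eq_bigr => i _.
  by rewrite /F -ltnS ltn_ord natz PoszM mulrC.
rewrite (eq_bigr (fun i : 'I_r.+1 => \sum_(k < r.+1)
    ('C(d, s - i))%:Z * (c i k * ('C(d + p, k))%:Z))); last first.
  by move=> i _; rewrite (cP i _ p) // mulr_sumr.
rewrite exchange_big; apply: eq_bigr => k _ /=; rewrite mulr_suml.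
by apply: eq_bigr => i _; rewrite mulrA.
Qed.

(** * Generic spaces of dependences *)

Definition pos (R : realFieldType) n (w : 'rV[R]_n) : {set 'I_n} :=
  [set i | 0 < w 0 i].

Definition zer (R : realFieldType) n (w : 'rV[R]_n) : {set 'I_n} :=
  [set i | w 0 i == 0].

Lemma small_perturbation (R : realFieldType) n (w u : 'rV[R]_n) :
  exists2 e : R, 0 < e & forall i,
    (0 < w 0 i -> 0 < w 0 i + e * u 0 i) /\ (w 0 i < 0 -> w 0 i + e * u 0 i < 0).
Proof.
(* Division by zero gives 0, so the zero entries of [w] add nothing; at the others [1 + t] exceeds
   the ratio of [u] to [w]. *)
pose t := \sum_i `|u 0 i| / `|w 0 i|.
have t0 : 0 <= t by apply: sumr_ge0 => i _; rewrite divr_ge0.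
exists (1 + t)^-1 => [|i]; first by rewrite invr_gt0; lra.
have lt : w 0 i != 0 -> (1 + t)^-1 * `|u 0 i| < `|w 0 i|.
  move=> wi0; rewrite mulrC ltr_pdivrMr; last lra.
  rewrite -ltr_pdivrMl ?normr_gt0 // mulrC.
  apply: (@le_lt_trans _ _ t); last lra.
  by rewrite /t (bigD1 i) //= lerDl sumr_ge0 // => j _; rewrite divr_ge0.
have e0 : 0 < (1 + t)^-1 by rewrite invr_gt0; lra.
have := ler_norm ((1 + t)^-1 * u 0 i).
have := ler_norm (- ((1 + t)^-1 * u 0 i)).
rewrite normrN normrM (gtr0_norm e0).
split => w0.
  by have := lt (lt0r_neq0 w0); rewrite (gtr0_norm w0); lra.
by have := lt (ltr0_neq0 w0); rewrite (ltr0_norm w0); lra.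
Qed.

(* The dependences of the rows of [B] are the [w] with [w *m B = 0]; the two
   conditions force them to form a space of dimension [r] in general position. *)
Definition generic (R : realFieldType) n m (B : 'M[R]_(n, m)) (r : nat) : Prop :=
  n = (m + r)%N /\
  forall w : 'rV[R]_n, w *m B = 0 -> w != 0 -> (#|zer w| < r)%N.

Section Generic.
Variables (R : realFieldType) (n m : nat) (B : 'M[R]_(n, m)) (r : nat).
Hypothesis genB : generic B r.

(** Enlarge [Z] to [r - 1] indices still missing [j]. The dependences vanishing there form the left
    kernel of a matrix with [m + r] rows and [m + r - 1] columns, so a nonzero one exists; a further
    zero at [j] would contradict genericity. *)
Lemma generic_separate (Z : {set 'I_n}) (j : 'I_n) :
  (#|Z| < r)%N -> j \notin Z ->
  exists u : 'rV[R]_n, [/\ u *m B = 0, Z \subset zer u & 0 < u 0 j].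
Proof.
case: genB => nE gB Zr jZ.
have [Y [ZY Yj Yr]] : exists Y : {set 'I_n},
    [/\ Z \subset Y, Y \subset ~: [set j] & #|Y| = r.-1].
  apply: subset_of_card; first by rewrite subsetC sub1set inE.
  by rewrite cardsC1 card_ord; lia.
pose C : 'M[R]_(n, #|Y|) := \matrix_(i, k) (i == enum_val k)%:R.
have /rowV0Pn[u] : kermx (row_mx B C) != 0.
  rewrite -mxrank_eq0 mxrank_ker; have := rank_leq_col (row_mx B C); lia.
rewrite sub_kermx mul_mx_row => /eqP uBC u0.
have [uB uC] : u *m B = 0 /\ u *m C = 0.
  by apply: eq_row_mx; rewrite uBC row_mx0.
have Yu : Y \subset zer u.
  apply/subsetP => i iY; rewrite inE.
  move/rowP/(_ (enum_rank_in iY i)): uC; rewrite !mxE => uC.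
  rewrite -{}[X in _ == X]uC (bigD1 i) //= mxE enum_rankK_in // eqxx mulr1.
  rewrite big1 ?addr0 // => k ki.
  by rewrite mxE enum_rankK_in // (negbTE ki) mulr0.
have uj : u 0 j != 0.
  apply/negP => uj; have := gB _ uB u0.
  suff : (#|j |: Y| <= #|zer u|)%N.
    rewrite cardsU1 Yr (_ : j \notin Y) ?add1n; first by lia.
    by apply/negP => /(subsetP Yj); rewrite !inE eqxx.
  by apply: subset_leq_card; rewrite subUset sub1set Yu inE uj.
have [uj0|uj0] := ltP 0 (u 0 j).
  by exists u; split=> //; apply: subset_trans Yu.
exists (- u); split; first by rewrite mulNmx uB oppr0.
  apply/subsetP => i iZ.
  by have := subsetP Yu i (subsetP ZY i iZ); rewrite !inE mxE oppr_eq0.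
by rewrite mxE oppr_gt0 lt_neqAle uj.
Qed.

(** In Gale terms: the Gale vectors indexed by [S] lie in an open half-space bounded by a hyperplane
    through the origin. *)
Definition pointed (S : {set 'I_n}) : bool :=
  `[< exists2 w : 'rV[R]_n, w *m B = 0 & S \subset pos w >].

(** Add up, over [j] in [S], dependences that are positive at [j] and vanish on the rest of [S];
    they exist since [S :\ j] has fewer than [r] elements. *)
Lemma pointed_small (S : {set 'I_n}) : (#|S| <= r)%N -> pointed S.
Proof.
move=> Sr; apply/asboolP.
have /choice[u uP] : forall j, exists u : 'rV[R]_n, j \in S ->
    [/\ u *m B = 0, S :\ j \subset zer u & 0 < u 0 j].
  move=> j; have [jS|] := boolP (j \in S); last by exists 0.
  have [||u uP] := @generic_separate (S :\ j) j; last by exists u.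
    by rewrite (cardsD1 j) jS in Sr; lia.
  by rewrite !inE eqxx.
exists (\sum_(j in S) u j).
  by rewrite mulmx_suml big1 // => j /uP[].
apply/subsetP => i iS; rewrite inE summxE (bigD1 i) //= big1 ?addr0.
  by have [] := uP i iS.
move=> j /andP[jS ji]; have [_ /subsetP/(_ i)] := uP j jS.
by rewrite !inE iS eq_sym ji => /(_ isT)/eqP.
Qed.

(** The zero set of [w] has fewer than [r] elements, hence is pointed. A small multiple of a
    dependence positive there lifts the zeros of [w] and keeps its positive entries positive. *)
Lemma pointed_of_semipositive (S : {set 'I_n}) (w : 'rV[R]_n) :
  w *m B = 0 -> w != 0 -> (forall i, i \in S -> 0 <= w 0 i) -> pointed S.
Proof.
move=> wB w0 wS; have [_ gB] := genB.
have /asboolP[u uB /subsetP uS] : pointed (zer w).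
  by apply: pointed_small; apply: ltnW; apply: gB.
have [e e0 eP] := small_perturbation w u.
apply/asboolP; exists (w + e *: u).
  by rewrite mulmxDl wB -scalemxAl uB scaler0 addr0.
apply/subsetP => i iS; rewrite inE !mxE.
have [wi0|wi0] := eqVneq (w 0 i) 0.
  by rewrite wi0 add0r mulr_gt0 //; have := uS i; rewrite !inE wi0 eqxx; apply.
by apply: (eP i).1; rewrite lt_neqAle eq_sym wi0 wS.
Qed.

(* A sign vector, restricted to the coordinates in [A], is encoded by its positive
   and its zero sets. *)
Definition traces (A : {set 'I_n}) : {set {set 'I_n} * {set 'I_n}} :=
  [set X | `[< exists2 w : 'rV[R]_n, w *m B = 0 & X = (pos w :&: A, zer w :&: A) >]].

(* The minimum is the codimension of the cell with zero set [Z]: the zero vector has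
   codimension [r], however many coordinates there are. *)
Definition weight (Z : {set 'I_n}) : int := (-1) ^+ minn #|Z| r.

End Generic.

Section EulerRelation.

(** * Euler's relation and the number of pointed sets *)

Variables (R : realFieldType) (n m : nat) (B : 'M[R]_(n, m)) (r : nat).
Hypothesis genB : generic B r.

Lemma tracesP (A P Z : {set 'I_n}) : reflect
  (exists w : 'rV[R]_n, [/\ w *m B = 0, P = pos w :&: A & Z = zer w :&: A])
  ((P, Z) \in traces B A).
Proof.
rewrite inE; apply: (iffP (asboolP _)).
  by move=> [w wB [-> ->]]; exists w.
by move=> [w [wB -> ->]]; exists w.
Qed.

Lemma setD1_id (D : {set 'I_n}) (j : 'I_n) : j \notin D -> D :\ j = D.
Proof. by move=> jD; apply/setDidPl; rewrite disjoint_sym disjoints1. Qed.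

Lemma setU1I_eq (A D : {set 'I_n}) (j : 'I_n) :
  D :&: (j |: A) = if j \in D then j |: (D :&: A) else D :&: A.
Proof.
case: ifP => jD; apply/setP => i; rewrite !inE; case: eqVneq => // ->.
  by rewrite jD.
by rewrite jD.
Qed.

(* The hyperplane of the new coordinate [j] either misses the cell [X], or cuts it
   into three cells whose weights add up to that of [X], or contains it, the latter
   only when [X] is the zero cell. *)
Lemma traces_step (A : {set 'I_n}) (j : 'I_n) (X : {set 'I_n} * {set 'I_n}) :
  j \notin A -> X \in traces B A ->
  weight r X.2 =
    ((j |: X.1, X.2) \in traces B (j |: A))%:R * weight r X.2 +
    ((X.1, j |: X.2) \in traces B (j |: A))%:R * weight r (j |: X.2) +
    ((X.1, X.2) \in traces B (j |: A))%:R * weight r X.2.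
Proof.
case: X => P Z jA /tracesP[w [wB PE ZE]] /=.
have [jP jZ] : j \notin P /\ j \notin Z by rewrite PE ZE !inE (negbTE jA) !andbF.
have setU1_inj (D D' : {set 'I_n}) :
    j \notin D -> j \notin D' -> j |: D = j |: D' -> D = D'.
  by move=> jD jD' E; rewrite -(setU1K jD) E setU1K.
(* The three possible refinements of the cell: entry [j] positive, zero or negative. *)
have posP : reflect (exists u : 'rV[R]_n,
     [/\ u *m B = 0, P = pos u :&: A, Z = zer u :&: A & 0 < u 0 j])
    ((j |: P, Z) \in traces B (j |: A)).
  apply: (iffP (tracesP _ _ _)) => [[u [uB]]|[u [uB PuE ZuE uj]]].
    rewrite !setU1I_eq !inE; case: ltgtP => uj PuE ZuE.
    - by exists u; split=> //; apply: setU1_inj; rewrite // !inE (negbTE jA) andbF.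
    - by exfalso; move: (setU11 j P); rewrite PuE !inE (negbTE jA) andbF.
    - by exfalso; move: jZ; rewrite ZuE setU11.
  by exists u; rewrite !setU1I_eq !inE uj gt_eqF // PuE ZuE.
have zerP : reflect (exists u : 'rV[R]_n,
     [/\ u *m B = 0, P = pos u :&: A, Z = zer u :&: A & u 0 j = 0])
    ((P, j |: Z) \in traces B (j |: A)).
  apply: (iffP (tracesP _ _ _)) => [[u [uB]]|[u [uB PuE ZuE uj]]].
    rewrite !setU1I_eq !inE; case: ltgtP => uj PuE ZuE.
    - by exfalso; move: jP; rewrite PuE setU11.
    - by exfalso; move: (setU11 j Z); rewrite ZuE !inE (negbTE jA) andbF.
    - by exists u; split=> //; apply: setU1_inj; rewrite // !inE (negbTE jA) andbF.
  by exists u; rewrite !setU1I_eq !inE uj ltxx eqxx PuE ZuE.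
have negtP : reflect (exists u : 'rV[R]_n,
     [/\ u *m B = 0, P = pos u :&: A, Z = zer u :&: A & u 0 j < 0])
    ((P, Z) \in traces B (j |: A)).
  apply: (iffP (tracesP _ _ _)) => [[u [uB]]|[u [uB PuE ZuE uj]]].
    rewrite !setU1I_eq !inE; case: ltgtP => uj PuE ZuE.
    - by exfalso; move: jP; rewrite PuE setU11.
    - by exists u.
    - by exfalso; move: jZ; rewrite ZuE setU11.
  by exists u; rewrite !setU1I_eq !inE lt_gtF // lt_eqF // PuE ZuE.
have [_ gB] := genB.
have [Zr|rZ] := ltnP #|Z| r; last first.
  (* With at least [r] zeros only the zero vector is left, and the minimum in [weight] keeps its
     weight unchanged. *)
  have all0 u : u *m B = 0 -> Z = zer u :&: A -> u = 0.
    move=> uB ZuE; apply/eqP; apply: contraTT rZ => u0; rewrite -ltnNge.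
    by apply: leq_ltn_trans (gB u uB u0); rewrite ZuE subset_leq_card ?subsetIl.
  have -> : (j |: P, Z) \in traces B (j |: A) = false.
    by apply/posP => -[u [uB _ /(all0 u uB)->]]; rewrite mxE ltxx.
  have -> : (P, Z) \in traces B (j |: A) = false.
    by apply/negtP => -[u [uB _ /(all0 u uB)->]]; rewrite mxE ltxx.
  have -> : (P, j |: Z) \in traces B (j |: A).
    by apply/zerP; exists w; split=> //; rewrite (all0 w) // mxE.
  rewrite !mul0r add0r addr0 mul1r /weight cardsU1 jZ.
  by congr (_ ^+ _); lia.
have wgtU : weight r (j |: Z) = - weight r Z.
  rewrite /weight cardsU1 jZ add1n (minn_idPl Zr) (minn_idPl (ltnW Zr)).
  by rewrite exprS mulN1r.
(* The cell is closed under positive combinations. *)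
have combine u u' : u *m B = 0 -> u' *m B = 0 ->
    P = pos u :&: A -> Z = zer u :&: A -> P = pos u' :&: A -> Z = zer u' :&: A ->
    forall a b : R, 0 < a -> 0 < b ->
    let t := a *: u + b *: u' in
    [/\ t *m B = 0, P = pos t :&: A & Z = zer t :&: A].
  move=> uB u'B PuE ZuE Pu'E Zu'E a b a0 b0 t; split.
  - by rewrite mulmxDl -!scalemxAl uB u'B !scaler0 addr0.
  - apply/setP => i; move/setP/(_ i): (PuE); move/setP/(_ i): (ZuE).
    move/setP/(_ i): (Pu'E); move/setP/(_ i): (Zu'E).
    rewrite !inE !mxE; case: (i \in A); rewrite ?andbF ?andbT //.
    move=> -> -> e1 e2; move: e1 e2.
    case: (ltgtP (u 0 i) 0) => h; case: (ltgtP (u' 0 i) 0) => // h' _ _.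
    + by rewrite lt_gtF // -oppr_gt0; nra.
    + by symmetry; nra.
    + by rewrite h h' !mulr0 addr0 ltxx.
  - apply/setP => i; move/setP/(_ i): (PuE); move/setP/(_ i): (ZuE).
    move/setP/(_ i): (Pu'E); move/setP/(_ i): (Zu'E).
    rewrite !inE !mxE; case: (i \in A); rewrite ?andbF ?andbT //.
    move=> -> -> e1 e2; move: e1 e2.
    case: (ltgtP (u 0 i) 0) => h; case: (ltgtP (u' 0 i) 0) => // h' _ _.
    + by symmetry; rewrite lt_eqF //; nra.
    + by symmetry; rewrite gt_eqF //; nra.
    + by rewrite h h' !mulr0 addr0 eqxx.
have [zj|nzj] := boolP ((P, j |: Z) \in traces B (j |: A)).
  have [u [uB PuE ZuE uj]] := zerP zj.
  (* Since [v] vanishes on [Z], small moves from [u] along [v] and [- v] stay in the cell and reach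
     both sides of the hyperplane. All three refinements occur, with signs adding up to one
     weight. *)
  have [v [vB Zv vj]] := generic_separate genB Zr jZ.
  have perturb s : exists2 e : R, 0 < e &
      let t := u + (e * s) *: v in
      [/\ t *m B = 0, P = pos t :&: A & Z = zer t :&: A].
    have [e e0 eP] := small_perturbation u (s *: v).
    exists e => //=; split.
    - by rewrite mulmxDl -scalemxAl uB vB scaler0 addr0.
    - apply/setP => i; rewrite PuE !inE !mxE; case iA: (i \in A); rewrite ?andbF ?andbT //.
      have := eP i; rewrite !mxE mulrA; case: (ltgtP (u 0 i) 0) => ui [h1 h2].
      + by rewrite lt_gtF // h2.
      + by rewrite h1.
      + have : i \in zer v by apply: (subsetP Zv); rewrite ZuE !inE ui eqxx iA.
        by rewrite inE => /eqP ->; rewrite ui mulr0 addr0 ltxx.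
    - apply/setP => i; rewrite ZuE !inE !mxE; case iA: (i \in A); rewrite ?andbF ?andbT //.
      have := eP i; rewrite !mxE mulrA; case: (ltgtP (u 0 i) 0) => ui [h1 h2].
      + by rewrite lt_eqF // h2.
      + by rewrite gt_eqF // h1.
      + have : i \in zer v by apply: (subsetP Zv); rewrite ZuE !inE ui eqxx iA.
        by rewrite inE => /eqP ->; rewrite ui mulr0 addr0 eqxx.
  have -> : (j |: P, Z) \in traces B (j |: A).
    have [e e0 [tB PtE ZtE]] := perturb 1; apply/posP; eexists; split; eauto.
    by rewrite !mxE uj add0r; nra.
  have -> : (P, Z) \in traces B (j |: A).
    have [e e0 [tB PtE ZtE]] := perturb (-1); apply/negtP; eexists; split; eauto.
    by rewrite !mxE uj add0r; nra.
  by rewrite wgtU; lia.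
have [/posP[u [uB PuE ZuE uj]]|npj] := boolP ((j |: P, Z) \in traces B (j |: A)).
  have -> : (P, Z) \in traces B (j |: A) = false.
    apply/negtP => -[u' [u'B Pu'E Zu'E u'j]]; case/zerP: nzj.
    (* These coefficients cancel entry [j]: vectors on both sides would give one on the
       hyperplane. *)
    have [||tB PtE ZtE] :=
      combine u u' uB u'B PuE ZuE Pu'E Zu'E (- u' 0 j) (u 0 j); rewrite ?oppr_gt0 //.
    by eexists; split; eauto; rewrite !mxE; lra.
  by lia.
have -> : (P, Z) \in traces B (j |: A).
  apply/negtP; exists w; split=> //; case: ltgtP => // wj.
    by case/posP: npj; exists w.
  by case/zerP: nzj; exists w.
by lia.
Qed.

(** Group the sign vectors on [j |: A] by their restriction to [A]; [traces_step] evaluates each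
    fibre. *)
Lemma euler_step (A S : {set 'I_n}) (j : 'I_n) : j \notin A -> S \subset A ->
  \sum_(X in traces B (j |: A) | S \subset X.1) weight r X.2 =
  \sum_(X in traces B A | S \subset X.1) weight r X.2.
Proof.
move=> jA SA.
pose h (X : {set 'I_n} * {set 'I_n}) := (X.1 :\ j, X.2 :\ j).
rewrite (partition_big h (fun X => (X \in traces B A) && (S \subset X.1))); last first.
  move=> [P Z] /andP[/tracesP[w [wB -> ->]] /= sS]; apply/andP; split.
    apply/tracesP; exists w; split=> //;
    by apply/setP => i; rewrite !inE; case: eqVneq => // ->; rewrite (negbTE jA) andbF.
  by rewrite subsetD1 sS; apply: contra jA => /(subsetP SA).
apply: eq_bigr => -[P Z] /= /andP[XA SP]; rewrite [RHS](traces_step jA XA) /=.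
have [jP jZ] : j \notin P /\ j \notin Z.
  by move/tracesP: XA => [w [_ -> ->]]; rewrite !inE (negbTE jA) !andbF.
pose l := [:: (j |: P, Z); (P, j |: Z); (P, Z)].
have neP : P != j |: P by apply: contraNneq jP => ->; rewrite setU11.
have neZ : Z != j |: Z by apply: contraNneq jZ => ->; rewrite setU11.
have ul : uniq l.
  rewrite /= !inE !xpair_eqE ![j |: _ == _]eq_sym !(negbTE neP) !(negbTE neZ).
  by rewrite !andbF.
have -> : ((j |: P, Z) \in traces B (j |: A))%:R * weight r Z +
    ((P, j |: Z) \in traces B (j |: A))%:R * weight r (j |: Z) +
    ((P, Z) \in traces B (j |: A))%:R * weight r Z =
    \sum_(X <- l) (X \in traces B (j |: A))%:R * weight r X.2.
  by rewrite !big_cons big_nil addr0 addrA.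
rewrite big_uniq // [LHS]big_mkcond [RHS]big_mkcond; apply: eq_bigr => -[P' Z'] _.
rewrite /h /= xpair_eqE; case: ifP => [/andP[/andP[XjA SP'] /andP[/eqP PE /eqP ZE]]|nX].
  have -> : (P', Z') \in l.
    move/tracesP: XjA => [w [_ P'E Z'E]].
    rewrite !inE !xpair_eqE.
    case jP': (j \in P'); case jZ': (j \in Z').
    - move: jP' jZ'; rewrite P'E Z'E !inE => /andP[wj _] /andP[/eqP wj0 _].
      by rewrite wj0 ltxx in wj.
    - by rewrite -PE -ZE setD1K // (setD1_id (negbT jZ')) !eqxx.
    - by rewrite -PE -ZE (setD1_id (negbT jP')) setD1K // !eqxx orbT.
    - by rewrite -PE -ZE (setD1_id (negbT jP')) (setD1_id (negbT jZ')) !eqxx !orbT.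
  by rewrite XjA mul1r.
case: ifP => // Xl; have [XjA|XjA] := boolP (_ \in _); last by rewrite mul0r.
suff E : [&& S \subset P', P' :\ j == P & Z' :\ j == Z] by rewrite XjA E in nX.
have SjP : S \subset j |: P by apply: subset_trans SP (subsetU1 _ _).
move: Xl; rewrite !inE => /or3P[] /eqP[-> ->];
  by rewrite ?SjP ?SP ?setU1K ?setD1_id ?eqxx.
Qed.

(** Remove the coordinates of [A :\: S] one by one. On [S] itself the only candidate is the
    all-positive sign vector, of weight 1, which occurs exactly when [S] is pointed. *)
Lemma euler (A S : {set 'I_n}) : S \subset A ->
  \sum_(X in traces B A | S \subset X.1) weight r X.2 = (pointed B S)%:R.
Proof.
have [k kE] := ubnP #|A :\: S|; elim: k => // k IH in A kE * => SA.
have [AS0|/set0Pn[j]] := eqVneq (A :\: S) set0.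
  have -> : A = S by apply/eqP; rewrite eqEsubset SA -setD_eq0 AS0 eqxx.
  have -> : pointed B S = ((S, set0) \in traces B S).
    apply/asboolP/tracesP => [[w wB wS]|[w [wB wS _]]]; exists w => //.
      split=> //; first by rewrite (setIidPr wS).
      apply/setP => i; rewrite !inE; apply/esym/negbTE/negP => /andP[/eqP wi iS].
      by have := subsetP wS i iS; rewrite inE wi ltxx.
    by rewrite wS subsetIl.
  rewrite (eq_bigl (fun X => (X == (S, set0)) && ((S, set0) \in traces B S))).
    rewrite big_mkcondr big_pred1_eq /weight cards0 min0n expr0.
    by case: ifP.
  move=> [P Z]; rewrite xpair_eqE; apply/andP/andP => -[].
    move=> PZ /= SP; move/tracesP: (PZ) => [w [wB PE ZE]].
    have PS : P = S by apply/eqP; rewrite eqEsubset SP PE subsetIr.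
    have Z0 : Z = set0.
      apply/setP => i; rewrite ZE !inE; apply/negbTE/negP => /andP[/eqP wi iS].
      by move: iS; rewrite -{1}PS PE !inE wi ltxx.
    by rewrite PS Z0 in PZ *; rewrite PZ !eqxx.
  by move=> /andP[/eqP-> /eqP->] ->; split.
rewrite inE => /andP[jS jA].
rewrite -(setD1K jA) euler_step ?setD11 //; last by rewrite subsetD1 SA.
apply: IH; last by rewrite subsetD1 SA.
apply: leq_trans (_ : #|A :\: S| <= k)%N => //.
apply: proper_card; apply/properP; split; first by rewrite setSD ?subD1set.
by exists j; rewrite !inE ?jS ?jA ?eqxx ?andbF.
Qed.

Lemma traces0 (A : {set 'I_n}) : (set0, A) \in traces B A.
Proof.
apply/tracesP; exists 0; split; first exact: mul0mx.
  by apply/setP => i; rewrite !inE mxE ltxx.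
by apply/setP => i; rewrite !inE mxE eqxx.
Qed.

(** Sum [euler] over the [S] of size [s] and exchange: a cell is counted once for each [s]-subset of
    its positive set. *)
Lemma card_pointed (A : {set 'I_n}) (s : nat) :
  #|[set S : {set 'I_n} | [&& S \subset A, #|S| == s & pointed B S]]|%:Z =
  \sum_(X in traces B A) weight r X.2 * ('C(#|X.1|, s))%:Z.
Proof.
rewrite -sum1_card -natz natr_sum.
rewrite (eq_bigl (fun S : {set 'I_n} => [&& S \subset A & #|S| == s] && pointed B S)); last first.
  by move=> S; rewrite inE andbA.
rewrite big_mkcondr /=.
rewrite (eq_bigr (fun S : {set 'I_n} =>
    \sum_(X in traces B A) if S \subset X.1 then weight r X.2 else 0)).
  rewrite exchange_big; apply: eq_bigr => -[P Z] /= /tracesP[w [_ PE _]].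
  rewrite -big_mkcondr /= sumr_const -mulr_natr; congr (_ * _).
  rewrite natz -cards_draws -cardsE; congr (Posz #|pred_of_set _|).
  apply/setP => S; rewrite !inE unfold_in /= andbC.
  case SP: (S \subset P) => //=; rewrite (subset_trans SP) //.
  by rewrite PE subsetIr.
move=> S /andP[SA _]; rewrite -big_mkcondr euler //.
by case: (pointed B S).
Qed.

(* The subtracted term is the contribution of the zero vector, whose positive set
   is empty and thus outside the range of the interpolation formula. *)
Definition pointed_number (d M s : nat) : int :=
  \sum_(k < r.+1) sval (cid (binomial_interpolation r d s)) k *
    (('C(M, k))%:Z - (k == 0 :> nat)%:R * (-1) ^+ r).

Lemma card_pointedE (A : {set 'I_n}) (d s : nat) :
  (r <= #|A|)%N ->
  (forall w : 'rV[R]_n, w *m B = 0 -> w != 0 -> (d <= #|pos w :&: A| <= d + r)%N) ->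
  (0 < s)%N ->
  #|[set S : {set 'I_n} | [&& S \subset A, #|S| == s & pointed B S]]|%:Z =
  pointed_number d #|A| s.
Proof.
move=> rA dA s0; rewrite card_pointed (bigD1 (set0, A)) ?traces0 //=.
rewrite cards0 bin0n (gtn_eqF s0) mulr0 add0r /pointed_number.
case: cid => c /= cP.
rewrite (eq_bigr (fun X : {set 'I_n} * {set 'I_n} => \sum_(k < r.+1)
    c k * (weight r X.2 * ('C(#|X.1|, k))%:Z))); last first.
  move=> -[P Z] /= /andP[/tracesP[w [wB PE ZE]] nX].
  have w0 : w != 0.
    apply: contraNneq nX => w0; rewrite PE ZE w0 xpair_eqE.
    by apply/andP; split; apply/eqP/setP => i; rewrite !inE mxE ?ltxx ?eqxx.
  have /andP[dP Pr] := dA w wB w0; rewrite -PE in dP Pr.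
  have := cP (#|P| - d)%N; rewrite subnKC // => ->; last lia.
  by rewrite mulr_sumr; apply: eq_bigr => k _; rewrite mulrCA.
rewrite exchange_big; apply: eq_bigr => k _ /=; rewrite -mulr_sumr; congr (_ * _).
(* For [k <= r] all [k]-subsets of [A] are pointed, so [card_pointed] evaluates the sum over the
   nonzero cells. *)
have := card_pointed A k; rewrite (bigD1 (set0, A)) ?traces0 //=.
rewrite cards0 bin0n {1}/weight (minn_idPr rA) => E.
have -> : ('C(#|A|, k))%:Z =
    #|[set S : {set 'I_n} | [&& S \subset A, #|S| == k & pointed B S]]|%:Z.
  congr Posz; rewrite -cards_draws; apply: eq_card => S; rewrite !inE.
  case: eqP => Sk; rewrite ?andbF // (pointed_small genB) ?andbT //.
  by rewrite Sk -ltnS.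
by rewrite {}E natz [X in _ + _ - X]mulrC addrAC subrr add0r.
Qed.

End EulerRelation.

(** * Theorems of the alternative *)

(** Induction on [S]: if the functional [a] found for [S :\ s] fails at [s], one eliminates row [s]
    and applies the induction hypothesis again. *)
Lemma gordan (R : realFieldType) (N m : nat) (S : {set 'I_N}) (B : 'M[R]_(N, m)) :
  (exists a : 'cV[R]_m, forall i, i \in S -> 0 < (B *m a) i 0) \/
  (exists w : 'rV[R]_N, [/\ w *m B = 0, forall i, 0 <= w 0 i,
     forall i, i \notin S -> w 0 i = 0 & exists2 i, i \in S & 0 < w 0 i]).
Proof.
have [k kE] := ubnP #|S|; elim: k => // k IH in S B kE *.
have [->|/set0Pn[s sS]] := eqVneq S set0.
  by left; exists 0 => i; rewrite inE.
have kE' : (#|S :\ s| < k)%N by rewrite (cardsD1 s) sS in kE.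
have [[a aP]|[w [wB w0 wS [i /setD1P[_ iS] wi]]]] := IH (S :\ s) B kE'; last first.
  right; exists w; split=> //; last by exists i.
  by move=> j jS; apply: wS; rewrite !inE (negbTE jS) andbF.
have [as0|as0] := ltP 0 ((B *m a) s 0).
  left; exists a => i iS; have [->//|si] := eqVneq i s.
  by apply: aP; rewrite !inE si iS.
(* Row [i] of [B'] combines rows [i] and [s] of [B] so that [a] vanishes on it; for [i] in [S :\ s]
   the coefficient of row [s] is positive and that of row [i] nonnegative. *)
pose B' := (B *m a) *m row s B - (B *m a) s 0 *: B.
have B'E b i : (B' *m b) i 0 =
    (B *m a) i 0 * (B *m b) s 0 - (B *m a) s 0 * (B *m b) i 0.
  rewrite mulmxBl -(mulmxA (B *m a)) -row_mul -scalemxAl !mxE big_ord1 !mxE.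
  by congr (_ * _ - _).
have [[b bP]|[w [wB w0 wS [i /setD1P[is_ iS] wi]]]] := IH (S :\ s) B' kE'; last first.
  have waE : w *m (B *m a) = ((w *m (B *m a)) 0 0)%:M by rewrite [LHS]mx11_scalar.
  have wa_ge j : 0 <= w 0 j * (B *m a) j 0.
    have [js|js] := boolP (j \in S :\ s); last by rewrite wS ?mul0r.
    by rewrite mulr_ge0 // ltW // aP.
  have wa0 : 0 < (w *m (B *m a)) 0 0.
    rewrite mxE (bigD1 i) //= ltr_pwDl ?sumr_ge0 //.
    by rewrite mulr_gt0 // aP // !inE is_ iS.
  move: wa0 waE as0; set e := (w *m _) 0 0; set c := (B *m a) s 0 => e0 waE c0.
  (* [w *m B' = 0] reads [e *: row s B = c *: (w *m B)], and [c <= 0 < e]. *)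
  right; exists (e *: delta_mx 0 s - c *: w); split.
  - rewrite mulmxBl -!scalemxAl -rowE -wB mulmxBr -scalemxAr.
    by rewrite (mulmxA w (B *m a)) waE mul_scalar_mx.
  - move=> j; rewrite !mxE /= subr_ge0 (@le_trans _ _ 0) //.
      by rewrite mulr_le0_ge0.
    by rewrite mulr_ge0 ?ler0n // ltW.
  - move=> j jS; rewrite !mxE /= wS ?mulr0 ?subr0; last first.
      by rewrite !inE (negbTE jS) andbF.
    by case: eqVneq jS => [->|_ _]; rewrite ?sS ?mulr0.
  - exists s => //; rewrite !mxE !eqxx mulr1 wS ?mulr0 ?subr0 //.
    by rewrite !inE eqxx.
have strict (c e : 'cV[R]_m) : (forall i, i \in S :\ s -> 0 < (B *m c) i 0) ->
    (B *m c) s 0 = 0 -> 0 < (B *m e) s 0 ->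
    exists a : 'cV[R]_m, forall i, i \in S -> 0 < (B *m a) i 0.
  move=> cP cs es.
  have [t t0 tP] := small_perturbation (B *m c)^T (B *m e)^T.
  exists (c + t *: e) => i iS; rewrite mulmxDr -scalemxAr.
  have [->|is_] := eqVneq i s.
    by rewrite mxE cs add0r mxE mulr_gt0.
  have := (tP i).1; rewrite !mxE => ->; rewrite //.
  by have := cP i; rewrite !inE is_ iS mxE; apply.
have [S0|/set0Pn[i0 i0S]] := eqVneq (S :\ s) set0.
  have [Bs0|Bs0] := eqVneq (row s B) 0.
    right; exists (delta_mx 0 s); split.
    - by rewrite -rowE.
    - by move=> i; rewrite mxE ler0n.
    - by move=> i iS; rewrite mxE /=; case: eqVneq iS => // ->; rewrite sS.
    - by exists s; rewrite // mxE !eqxx ltr01.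
  left; apply: (@strict 0 (row s B)^T).
  - by move=> i; rewrite S0 inE.
  - by rewrite mulmx0 mxE.
  - rewrite (_ : (_ *m _) s 0 = \sum_j B s j ^+ 2); last first.
      by rewrite mxE; apply: eq_bigr => j _; rewrite !mxE expr2.
    rewrite lt_neqAle sumr_ge0 ?andbT => [|j _]; last exact: sqr_ge0.
    apply: contraNneq Bs0 => /esym/eqP; rewrite psumr_eq0 => [/allP B0|j _]; last exact: sqr_ge0.
    apply/eqP/rowP => j; rewrite !mxE; apply/eqP; rewrite -sqrf_eq0.
    by apply: B0; rewrite mem_index_enum.
left; have := as0; rewrite le_eqVlt => /orP[/eqP as_|as_].
  apply: (@strict a b) => //.
  by have := bP _ i0S; rewrite B'E as_ mul0r subr0 pmulr_rgt0 // aP.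
(* This functional vanishes at [s] and equals [B' *m b] elsewhere; [- a] is positive at [s]. *)
apply: (@strict ((B *m b) s 0 *: a - (B *m a) s 0 *: b) (- a)).
- move=> i iS; rewrite mulmxBr -!scalemxAr !mxE.
  by have := bP i iS; rewrite B'E !mxE; lra.
- by rewrite mulmxBr -!scalemxAr !mxE; lra.
- by rewrite mulmxN mxE oppr_gt0.
Qed.

(** Gordan modulo the span of the rows outside [S]: functionals factoring through the cokernel
    vanish on those rows, and a dependence modulo their span is corrected by entries outside [S]. *)
Lemma stiemke (R : realFieldType) (N m : nat) (S : {set 'I_N}) (B : 'M[R]_(N, m)) :
  (exists a : 'cV[R]_m, (forall i, i \in S -> 0 < (B *m a) i 0) /\
     (forall i, i \notin S -> (B *m a) i 0 = 0)) \/
  (exists w : 'rV[R]_N, [/\ w *m B = 0, forall i, i \in S -> 0 <= w 0 i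
     & exists2 i, i \in S & 0 < w 0 i]).
Proof.
pose D : 'M[R]_N := diag_mx (\row_i (i \notin S)%:R).
have [[a aP]|[w [wB w0 wS [i iS wi]]]] := gordan S (B *m cokermx (D *m B)).
  left; exists (cokermx (D *m B) *m a); split=> i iS; rewrite mulmxA; first exact: aP.
  have : D *m (B *m cokermx (D *m B) *m a) = 0.
    by rewrite mulmxA (mulmxA D B) (mulmx_coker (D *m B)) mul0mx.
  by move/colP/(_ i); rewrite mul_diag_mx !mxE iS mul1r.
right; have /submxP[v vE] : (w *m B <= D *m B)%MS by rewrite submxE -mulmxA wB.
exists (w - v *m D); split.
- by rewrite mulmxBl vE mulmxA subrr.
- by move=> j jS; rewrite mul_mx_diag !mxE jS mulr0 subr0.
- by exists i => //; rewrite mul_mx_diag !mxE iS mulr0 subr0.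
Qed.

(** * Faces of polytopes *)

Local Open Scope classical_set_scope.
Local Open Scope card_scope.
Local Open Scope ring_scope.

Definition comb (R : realType) (N n : nat) (X : 'M[R]_(N, n)) (Z : {set 'I_N}) :
  set 'rV[R]_n :=
  [set y | exists l : 'rV[R]_N, [/\ forall i, 0 <= l 0 i, \sum_i l 0 i = 1,
     forall i, i \notin Z -> l 0 i = 0 & y = l *m X]].

Lemma convex_setP (R : realType) n (A : set 'rV[R]_n) :
  @convex_set R 'rV[R]_n A <->
  forall x y (t : R), A x -> A y -> 0 <= t <= 1 -> A (t *: x + (1 - t) *: y).
Proof.
split=> cA x y t.
  move=> Ax Ay /andP[t0 t1].
  by have := set_mem (cA x y (Itv01 t0 t1) (mem_set Ax) (mem_set Ay)).
move=> /set_mem Ax /set_mem Ay; apply/mem_set; apply: (cA x y t%:num Ax Ay).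
by rewrite ge0 le1.
Qed.

Lemma convex_hull_convex (R : realType) n (A : set 'rV[R]_n) :
  @convex_set R 'rV[R]_n (convex_hull A).
Proof.
apply/convex_setP => x y t Ax Ay t01 C [cC AC].
by move/convex_setP: (cC); apply=> //; [apply: Ax|apply: Ay].
Qed.

Lemma convex_hull_sub (R : realType) n (A C : set 'rV[R]_n) :
  @convex_set R 'rV[R]_n C -> A `<=` C -> convex_hull A `<=` C.
Proof. by move=> cC AC; apply: smallest_sub. Qed.

Lemma sub_convex_hull (R : realType) n (A : set 'rV[R]_n) : A `<=` convex_hull A.
Proof. exact: sub_gen_smallest. Qed.

Lemma comb_convex (R : realType) (N n : nat) (X : 'M[R]_(N, n)) (Z : {set 'I_N}) :
  @convex_set R 'rV[R]_n (comb X Z).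
Proof.
apply/convex_setP => x y t [l [l0 l1 lZ ->]] [k [k0 k1 kZ ->]] /andP[t0 t1].
exists (t *: l + (1 - t) *: k); split.
- by move=> i; rewrite !mxE addr_ge0 // mulr_ge0 // subr_ge0.
- under eq_bigr do rewrite !mxE.
  by rewrite big_split /= -!mulr_sumr l1 k1; ring.
- by move=> i iZ; rewrite !mxE lZ // kZ // !mulr0 addr0.
- by rewrite mulmxDl -!scalemxAl.
Qed.

Lemma row_comb (R : realType) (N n : nat) (X : 'M[R]_(N, n)) (Z : {set 'I_N}) i :
  i \in Z -> comb X Z (row i X).
Proof.
move=> iZ; exists (delta_mx 0 i); split.
- by move=> j; rewrite mxE ler0n.
- rewrite (bigD1 i) //= big1 ?addr0 ?mxE ?eqxx // => j ji.
  by rewrite mxE (negbTE ji).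
- by move=> j jZ; rewrite mxE; case: (eqVneq j i) jZ => [->|_ _]; rewrite ?iZ ?andbF.
- by rewrite -rowE.
Qed.

Lemma sum1_gt0 (R : realDomainType) (N : nat) (l : 'rV[R]_N) :
  (forall i, 0 <= l 0 i) -> \sum_i l 0 i = 1 -> exists i, 0 < l 0 i.
Proof.
move=> l0 l1; apply/existsP; apply: contraT; rewrite negb_exists => /forallP l_le.
have : \sum_i l 0 i = 0.
  by apply: big1 => i _; apply/le_anti; rewrite l0 andbT leNgt l_le.
by rewrite l1 => /eqP; rewrite oner_eq0.
Qed.

(** Induction on the number of positive coefficients: split off one point and rescale the others to
    sum 1. *)
Lemma comb_sub_convex (R : realType) (N n : nat) (X : 'M[R]_(N, n)) (A : set 'rV[R]_n)
    (l : 'rV[R]_N) :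
  @convex_set R 'rV[R]_n A -> (forall i, 0 <= l 0 i) -> \sum_i l 0 i = 1 ->
  (forall i, 0 < l 0 i -> A (row i X)) -> A (l *m X).
Proof.
move=> /convex_setP cA.
have [k kE] := ubnP #|pos l|; elim: k => // k IH in l kE * => l0 l1 lA.
have [i li0] := sum1_gt0 l0 l1.
have lE : 1 - l 0 i = \sum_(j | j != i) l 0 j.
  by rewrite -l1 (bigD1 i) //= addrAC subrr add0r.
have li1 : l 0 i <= 1 by rewrite -subr_ge0 lE sumr_ge0.
have [li|li] := eqVneq (l 0 i) 1.
  suff -> : l = delta_mx 0 i by rewrite -rowE; apply: lA.
  apply/rowP => j; rewrite mxE /=; case: eqVneq => [->//|ji].
  move/eqP: lE; rewrite li subrr eq_sym psumr_eq0 // => /allP/(_ j).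
  by rewrite mem_index_enum ji => /(_ isT)/eqP.
have li_lt : 0 < 1 - l 0 i by rewrite subr_gt0 lt_neqAle li.
pose l' : 'rV[R]_N := \row_j if j == i then 0 else l 0 j / (1 - l 0 i).
have -> : l *m X = l 0 i *: row i X + (1 - l 0 i) *: (l' *m X).
  rewrite rowE !scalemxAl -mulmxDl; congr (_ *m _).
  apply/rowP => j; rewrite !mxE /=; case: eqVneq => [->|ji].
    by rewrite mulr0 mulr1 addr0.
  by rewrite mulr0 add0r mulrC divfK // gt_eqF.
apply: cA; [exact: lA| |by rewrite l0 li1].
apply: IH.
- apply: leq_trans (_ : (#|pos l'| < #|pos l|)%N) _ => //.
  apply: proper_card; apply/properP; split.
    apply/subsetP => j; rewrite !inE mxE; case: eqP => [_|_]; first by rewrite ltxx.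
    by rewrite pmulr_lgt0 // invr_gt0.
  by exists i; rewrite !inE // mxE eqxx ltxx.
- move=> j; rewrite mxE; case: ifP => // _.
  by rewrite divr_ge0 // ltW.
- rewrite (bigD1 i) //= mxE eqxx add0r.
  rewrite (eq_bigr (fun j => l 0 j / (1 - l 0 i))) => [|j /negbTE ji]; last by rewrite mxE ji.
  by rewrite -mulr_suml -lE divff // gt_eqF.
- move=> j; rewrite mxE; case: eqP => [_|_]; first by rewrite ltxx.
  by rewrite pmulr_lgt0 ?invr_gt0 //; apply: lA.
Qed.

Lemma hull_comb (R : realType) (N n : nat) (X : 'M[R]_(N, n)) :
  convex_hull (range (fun i => row i X)) = comb X [set: 'I_N]%SET.
Proof.
apply/seteqP; split.
  by apply: convex_hull_sub; [exact: comb_convex|move=> _ [i _ <-]; exact: row_comb].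
move=> _ [l [l0 l1 _ ->]]; apply: comb_sub_convex => //.
  exact: convex_hull_convex.
by move=> i _; apply: sub_convex_hull; exists i.
Qed.

(** The gap [b - y *m a] at a convex combination is the average of the nonnegative gaps at the rows;
    it is zero iff only rows of gap zero are used. *)
Lemma comb_face (R : realType) (N n : nat) (X : 'M[R]_(N, n)) (a : 'cV[R]_n) (b : R) :
  (forall i, (X *m a) i 0 <= b) ->
  (forall y, comb X [set: 'I_N]%SET y -> (y *m a) 0 0 <= b) /\
  [set y | comb X [set: 'I_N]%SET y /\ (y *m a) 0 0 = b] =
  comb X [set i | (X *m a) i 0 == b]%SET.
Proof.
move=> Xb.
have gapE (l : 'rV[R]_N) : \sum_i l 0 i = 1 ->
    b - (l *m X *m a) 0 0 = \sum_i l 0 i * (b - (X *m a) i 0).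
  move=> l1; rewrite -mulmxA mxE -[X in X - _]mul1r -l1 mulr_suml -sumrB.
  by apply: eq_bigr => i _; rewrite mulrBr.
have gap_ge (l : 'rV[R]_N) i : 0 <= l 0 i -> 0 <= l 0 i * (b - (X *m a) i 0).
  by move=> l0; rewrite mulr_ge0 // subr_ge0.
split=> [_ [l [l0 l1 _ ->]]|].
  by rewrite -subr_ge0 gapE // sumr_ge0 // => i _; exact: gap_ge.
apply/seteqP; split.
  move=> _ [[l [l0 l1 _ ->]] lb]; exists l; split=> // i; rewrite inE => ib.
  have := gapE l l1; rewrite lb subrr => /esym/eqP.
  rewrite psumr_eq0 => [/allP/(_ i)|j _]; last exact: gap_ge.
  by rewrite mem_index_enum mulf_eq0 subr_eq0 (eq_sym b) (negbTE ib) orbF => /(_ isT)/eqP.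
move=> _ [l [l0 l1 lZ ->]]; split; first by exists l; split=> // i; rewrite inE.
apply/esym/eqP; rewrite -subr_eq0 gapE //; apply/eqP/big1 => i _.
have [/eqP ->|ib] := boolP ((X *m a) i 0 == b); first by rewrite subrr mulr0.
by rewrite lZ ?mul0r // inE.
Qed.

Definition face_set (R : realType) (N n : nat) (X : 'M[R]_(N, n)) (Z : {set 'I_N}) : bool :=
  `[< exists (a : 'cV[R]_n) (b : R), (forall i, (X *m a) i 0 <= b) /\
      Z = [set i | (X *m a) i 0 == b]%SET >].

Lemma is_face_comb (R : realType) (N n : nat) (X : 'M[R]_(N, n)) (F : set 'rV[R]_n) :
  is_face (comb X [set: 'I_N]%SET) F <-> exists2 Z, face_set X Z & F = comb X Z.
Proof.
split=> [[a [b [Pb ->]]]|[Z /asboolP[a [b [Xb ->]]] ->]]; last first.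
  by exists a, b; have [? <-] := comb_face Xb.
have Xb i : (X *m a) i 0 <= b.
  have := Pb (row i X); rewrite -row_mul mxE; apply.
  by apply: row_comb; rewrite inE.
exists [set i | (X *m a) i 0 == b]%SET; last by have [] := comb_face Xb.
by apply/asboolP; exists a, b.
Qed.

Lemma comb_row (R : realType) (N n : nat) (X : 'M[R]_(N, n)) (Z : {set 'I_N}) i :
  face_set X Z -> comb X Z (row i X) <-> i \in Z.
Proof.
move=> /asboolP[a [b [Xb ->]]]; split; last exact: row_comb.
by have [_ <-] := comb_face Xb => -[_]; rewrite -row_mul mxE inE => ->.
Qed.

(** A functional exposing a row in the whole polytope exposes it in the face. Conversely, a
    functional exposing [u] is also maximal at every row used by [u], so [u] is that row. *)
Lemma vertices_comb (R : realType) (N n : nat) (X : 'M[R]_(N, n)) (Z : {set 'I_N}) :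
  (forall i, vertices (comb X [set: 'I_N]%SET) (row i X)) -> face_set X Z ->
  vertices (comb X Z) = [set row i X | i in [set` Z]].
Proof.
move=> vX fZ; have sZ : comb X Z `<=` comb X [set: 'I_N]%SET.
  by move=> _ [l [l0 l1 lZ ->]]; exists l; split=> // i; rewrite inE.
apply/seteqP; split=> [u [a [b [Fb uE]]]|_ [i iZ <-]]; last first.
  have [a [b [Pb iE]]] := vX i.
  exists a, b; split; first by move=> y /sZ; exact: Pb.
  apply/seteqP; split=> [_ ->|y [yZ yb]].
    have : [set row i X] (row i X) by [].
    by rewrite iE => -[_ vb]; split=> //; exact: row_comb.
  suff : [set row i X] y by [].
  by rewrite iE; split=> //; exact: sZ.
have [[l [l0 l1 lZ lE]] ub] : comb X Z u /\ (u *m a) 0 0 = b.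
  by have : [set u] u by []; rewrite uE.
have [i li0] := sum1_gt0 l0 l1.
have iZ : i \in Z by apply: contraTT li0 => /lZ ->; rewrite ltxx.
exists i => //; suff : [set u] (row i X) by [].
rewrite uE; split; first exact: row_comb.
have gap_ge j : 0 <= l 0 j * (b - (X *m a) j 0).
  have [jZ|/lZ ->] := boolP (j \in Z); last by rewrite mul0r.
  rewrite mulr_ge0 // subr_ge0; have := Fb _ (row_comb X jZ).
  by rewrite -row_mul mxE.
have : \sum_j l 0 j * (b - (X *m a) j 0) = 0.
  under eq_bigr do rewrite mulrBr.
  by rewrite sumrB -mulr_suml l1 mul1r -{1}ub lE -mulmxA mxE subrr.
move/eqP; rewrite psumr_eq0 => [/allP/(_ i)|//].
rewrite mem_index_enum mulf_eq0 gt_eqF // subr_eq0 => /(_ isT) /eqP ->.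
by rewrite -row_mul mxE.
Qed.

Lemma card_set_finset (T : finType) (A : {set T}) (t : nat) :
  ([set` A] #= `I_t) <-> #|A| = t.
Proof.
have cA : [set` A] #= `I_#|A|.
  rewrite (card_eqr card_II); apply/card_esym.
  rewrite (_ : [set` A] = [set enum_val i | i in [set: 'I_#|A|]%classic]).
    rewrite card_eq_sym; apply: inj_card_eq => i j _ _; exact: enum_val_inj.
  apply/seteqP; split=> [x xA|_ [i _ <-]]; last exact: enum_valP.
  by exists (enum_rank_in xA x); rewrite ?enum_rankK_in.
split=> [At|<-//]; apply/card_eq_II.
by apply: card_eq_trans At; apply: card_esym.
Qed.

(** Reduces the count to finite sets: [comb X Z] determines a face set [Z], by [comb_row]. *)
Lemma card_faces_at (R : realType) (N n : nat) (X : 'M[R]_(N, n)) (i0 : 'I_N) (t : nat) :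
  injective (fun i => row i X) ->
  (forall i, vertices (comb X [set: 'I_N]%SET) (row i X)) ->
  faces_at (comb X [set: 'I_N]%SET) (row i0 X) t #=
  `I_#|[set Z : {set 'I_N} | [&& face_set X Z, i0 \in Z & #|Z| == t]]%SET|.
Proof.
move=> injX vX; set A := (X in #|pred_of_set X|).
have -> : faces_at (comb X [set: 'I_N]%SET) (row i0 X) t = [set comb X Z | Z in [set` A]].
  have cardZ Z : face_set X Z -> (vertices (comb X Z) #= `I_t) <-> #|Z| = t.
    move=> fZ; rewrite (vertices_comb vX fZ).
    rewrite -card_set_finset (card_eql (inj_card_eq _)) // => i j _ _; exact: injX.
  apply/seteqP; split=> [F [/is_face_comb[Z fZ ->] [vF tF]]|_ [Z + <-]].
    exists Z => //=; rewrite inE fZ /=; apply/andP; split; first exact/(comb_row i0 fZ).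
    exact/eqP/(cardZ Z fZ).
  rewrite /= inE => /and3P[fZ i0Z /eqP tZ]; split; first by apply/is_face_comb; exists Z.
  by split; [exact/(comb_row i0 fZ)|exact/(cardZ Z fZ)].
rewrite (card_eql (inj_card_eq _)); first exact/card_set_finset.
move=> Z Z' /set_mem + /set_mem; rewrite /= !inE => /and3P[fZ _ _] /and3P[fZ' _ _] ZZ'.
apply/setP => i; apply/idP/idP.
  by move/(comb_row i fZ); rewrite ZZ' => /(comb_row i fZ').
by move/(comb_row i fZ'); rewrite -ZZ' => /(comb_row i fZ).
Qed.

(** Gordan for the differences [q - p]: a functional positive on all of them exposes [p]; a
    nonnegative dependence, normalized to sum 1, writes [p] as a convex combination of the other
    points. *)
Lemma exposed_or_redundant (R : realType) n (s : seq 'rV[R]_n) (p : 'rV[R]_n) :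
  p \in s -> is_face (convex_hull [set` s]) [set p] \/
  convex_hull [set` s] = convex_hull [set` [seq q <- s | q != p]].
Proof.
move=> ps; set s' := [seq q <- s | q != p].
pose X : 'M[R]_(size s', n) := \matrix_i nth p s' i.
have Xs' i : row i X \in s' by rewrite rowK mem_nth.
have s'X q : q \in s' -> exists i, row i X = q.
  move=> qs'; have lt : (index q s' < size s')%N by rewrite index_mem.
  by exists (Ordinal lt); rewrite rowK nth_index.
have [[a aP]|[w [wX w0 _ [i _ wi]]]] := gordan [set: 'I_(size s')]%SET (X - const_mx 1 *m p).
  left; exists (- a), (- (p *m a) 0 0).
  have : convex_hull [set` s] `<=` [set y | y = p \/ (p *m a) 0 0 < (y *m a) 0 0].
    apply: convex_hull_sub => [|q /= qs]; last first.
      have [->|qp] := eqVneq q p; [by left|right].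
      have /s'X[i <-] : q \in s' by rewrite mem_filter qp.
      have := aP i; rewrite inE => /(_ isT).
      rewrite mulmxBl -mulmxA -row_mul !mxE big_ord1 !mxE mul1r subr_gt0.
      by [].
    apply/convex_setP => x y t xE yE /andP[t0 t1].
    have {}xE : x = p \/ (p *m a) 0 0 < (x *m a) 0 0 by exact: xE.
    have {}yE : y = p \/ (p *m a) 0 0 < (y *m a) 0 0 by exact: yE.
    rewrite /= mulmxDl -!scalemxAl.
    rewrite [X in _ < X]mxE [X in _ < X + _]mxE [X in _ < _ + X]mxE.
    have [->|t0'] := eqVneq t 0; first by rewrite scale0r add0r subr0 scale1r mul0r mul1r add0r.
    have [->|t1'] := eqVneq t 1; first by rewrite subrr scale0r addr0 scale1r mul0r mul1r addr0.
    have {}t0 : 0 < t by rewrite lt_neqAle eq_sym t0'.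
    have {}t1 : 0 < 1 - t by rewrite subr_gt0 lt_neqAle t1'.
    case: xE yE => [->|xp] [->|yp]; [left|right; nra..].
    by rewrite -scalerDl addrC subrK scale1r.
  move=> sP; split=> [y /sP[->|ya]|].
  - by rewrite mulmxN mxE.
  - by rewrite mulmxN mxE lerN2 ltW.
  apply/seteqP; split=> [_ ->|y [/sP[//|ya]]].
    by split; [exact: sub_convex_hull|rewrite mulmxN mxE].
  by rewrite mulmxN mxE => /oppr_inj yE; rewrite yE ltxx in ya.
right; have s's : [set` s'] `<=` [set` s] by move=> q; rewrite /= mem_filter => /andP[].
pose c := \sum_j w 0 j.
have c0 : 0 < c by rewrite /c (bigD1 i) //= ltr_pwDl // sumr_ge0.
have pE : p = (c^-1 *: w) *m X.
  apply: (@scalerI _ _ c); first by rewrite gt_eqF.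
  rewrite -scalemxAl scalerA divff ?gt_eqF // scale1r.
  have cE : w *m (const_mx 1 : 'cV_(size s')) = c%:M.
    apply/rowP => j; rewrite !mxE !ord1 eqxx; apply: eq_bigr => k _.
    by rewrite mxE mulr1.
  by move/eqP: wX; rewrite mulmxBr subr_eq0 mulmxA cE mul_scalar_mx => /eqP.
have ps' : convex_hull [set` s'] p.
  rewrite pE; apply: comb_sub_convex.
  - exact: convex_hull_convex.
  - by move=> j; rewrite mxE mulr_ge0 // invr_ge0 ltW.
  - by under eq_bigr do rewrite mxE; rewrite -mulr_sumr mulVf // gt_eqF.
  - by move=> j _; apply: sub_convex_hull; exact: Xs'.
apply/seteqP; split; apply: convex_hull_sub; try exact: convex_hull_convex.
  move=> q /= qs; have [->//|qp] := eqVneq q p.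
  by apply: sub_convex_hull; rewrite /= mem_filter qp.
by move=> q /s's; exact: sub_convex_hull.
Qed.

Lemma polytope_hull_vertices (R : realType) n (P : set 'rV[R]_n) :
  is_polytope P -> exists2 s : seq 'rV[R]_n,
    P = convex_hull [set` s] & [set` s] `<=` vertices P.
Proof.
move=> [s PE]; have [k kE] := ubnP (size s); elim: k => // k IH in s kE PE *.
have [sv|] := pselect ([set` s] `<=` vertices P); first by exists s.
rewrite -existsNE => -[p /not_implyP[/= ps np]].
have [pF|E] := exposed_or_redundant ps; first by case: np; rewrite /vertices /= PE.
apply: (IH [seq q <- s | q != p]); last by rewrite PE.
rewrite size_filter -(count_predC (pred1 p)) in kE *.
by rewrite -ltnS; apply: leq_trans kE; rewrite ltnS -add1n leq_add2r -has_count has_pred1.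
Qed.

Lemma polytope_comb (R : realType) (N n : nat) (X : 'M[R]_(N, n)) (P : set 'rV[R]_n) :
  is_polytope P -> vertices P = range (fun i => row i X) ->
  P = comb X [set: 'I_N]%SET.
Proof.
move=> /polytope_hull_vertices[s PE sv] vP; rewrite -hull_comb -vP.
apply/seteqP; split; rewrite {1}PE.
  apply: convex_hull_sub; first exact: convex_hull_convex.
  by move=> q /sv; exact: sub_convex_hull.
rewrite -PE; apply: convex_hull_sub; first by rewrite PE; exact: convex_hull_convex.
move=> q [a [b [_ qE]]]; have : [set q] q by [].
by rewrite qE => -[].
Qed.

(** * Faces and dependences *)

(** The column of ones turns affine dependences of the rows into linear ones, and affine forms into
    column vectors. *)
Definition homogenize (R : realType) (N n : nat) (X : 'M[R]_(N, n)) : 'M[R]_(N, n + 1) :=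
  row_mx X (const_mx 1).

Lemma homogenizeE (R : realType) (N n : nat) (X : 'M[R]_(N, n)) (a : 'cV[R]_n) (b : R) i :
  (homogenize X *m col_mx a (const_mx b : 'cV_1)) i 0 = (X *m a) i 0 + b.
Proof. by rewrite mul_row_col mxE [X in _ + X]mxE big_ord1 !mxE mul1r. Qed.

Lemma homogenize_sum (R : realType) (N n : nat) (X : 'M[R]_(N, n)) (w : 'rV[R]_N) :
  w *m homogenize X = 0 -> \sum_i w 0 i = 0.
Proof.
rewrite mul_mx_row -[0]row_mx0 => /eq_row_mx[_ /rowP/(_ 0)].
rewrite !mxE => wE; rewrite -[RHS]wE; apply: eq_bigr => i _.
by rewrite mxE mulr1.
Qed.

Lemma homogenize_gap (R : realType) (N n : nat) (X : 'M[R]_(N, n)) (w : 'rV[R]_N)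
    (a : 'cV[R]_n) (b : R) :
  w *m homogenize X = 0 -> \sum_i w 0 i * (b - (X *m a) i 0) = 0.
Proof.
move=> wX; pose C : 'cV[R]_(n + 1) := col_mx (- a) (const_mx b).
have : (w *m (homogenize X *m C)) 0 0 = 0 by rewrite mulmxA wX mul0mx mxE.
rewrite mxE => sum0; rewrite -[RHS]sum0; apply: eq_bigr => i _.
by rewrite homogenizeE mulmxN [(- (X *m a)) i 0]mxE addrC.
Qed.

Lemma face_setT (R : realType) (N n : nat) (X : 'M[R]_(N, n)) : face_set X [set: 'I_N]%SET.
Proof.
apply/asboolP; exists 0, 0; split=> [i|]; first by rewrite mulmx0 mxE.
by apply/setP => i; rewrite !inE mulmx0 mxE eqxx.
Qed.

(** Gale's face criterion. An affine form vanishing on [~: S] and positive on [S] pairs to zero with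
    every dependence, so none is positive on [S]. Without such a form, [stiemke] gives a dependence
    nonnegative on [S], which genericity makes positive there. *)
Lemma face_set_pointed (R : realType) (N n r : nat) (X : 'M[R]_(N, n)) (S : {set 'I_N}) :
  generic (homogenize X) r -> S != finset.set0 ->
  face_set X (~: S) = ~~ pointed (homogenize X) S.
Proof.
move=> gX /set0Pn[s sS]; apply/asboolP/negP.
  move=> [a [b [Xb SE]]] /asboolP[w /(homogenize_gap a b) w0 wS].
  move/eqP: w0; rewrite gt_eqF //.
  have gap i : i \in S = (0 < b - (X *m a) i 0).
    move/setP/(_ i): SE; rewrite !inE => SE.
    by rewrite subr_gt0 lt_neqAle Xb andbT -SE negbK.
  rewrite (bigD1 s) //= ltr_pwDl //.
    by rewrite mulr_gt0 -?gap //; move/subsetP/(_ s sS): wS; rewrite inE.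
  apply: sumr_ge0 => i _; have [iS|] := boolP (i \in S).
    by rewrite ltW // mulr_gt0 -?gap //; move/subsetP/(_ i iS): wS; rewrite inE.
  rewrite gap subr_gt0 -leNgt => ba.
  by rewrite (@le_anti _ _ b ((X *m a) i 0)) ?subrr ?mulr0 // ba Xb.
have [[a [aS aNS]]|[w [wX w0 [i iS wi]]]] := stiemke S (homogenize X); last first.
  case; apply: (pointed_of_semipositive gX wX) => //.
  by apply: contraTneq wi => ->; rewrite mxE ltxx.
move=> _; exists (- usubmx a), (dsubmx a 0 0).
have aE i : (homogenize X *m a) i 0 = (X *m usubmx a) i 0 + dsubmx a 0 0.
  rewrite -homogenizeE; congr ((_ *m _) _ _); rewrite -[LHS]vsubmxK.
  by congr (col_mx _ _); apply/colP => j; rewrite ord1 [RHS]mxE.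
split=> [i|].
  rewrite mulmxN mxE -subr_ge0 opprK addrC -aE.
  by have [/aS/ltW|/aNS ->] := boolP (i \in S).
apply/setP => i; rewrite !inE mulmxN mxE eq_sym -subr_eq0 opprK addrC -aE.
by have [/aS/gt_eqF|/aNS ->] := boolP (i \in S); rewrite ?eqxx.
Qed.

Lemma card_pos_neg_zer (R : realType) (N : nat) (w : 'rV[R]_N) (A : {set 'I_N}) :
  (#|pos w :&: A| + #|pos (- w) :&: A| + #|zer w :&: A|)%N = #|A|.
Proof.
rewrite -(cardsID (pos w) A) -(cardsID (pos (- w)) (A :\: pos w)) addnA.
congr (_ + _ + _)%N; apply: eq_card => i; rewrite !inE ?mxE ?oppr_gt0;
  by case: (i \in A); rewrite ?andbF ?andbT //; case: ltgtP.
Qed.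

(* [D./2] recovers [d] from [D = 2 * d]; the first branch is the polytope itself. *)
Definition face_number (r D t : nat) : nat :=
  let N := (D + 1 + r)%N in
  if t == N then 1%N else if (N < t)%N then 0%N else
  `|('C(N.-1, N - t))%:Z - pointed_number r D./2 N.-1 (N - t)|%N.

(** * Counting the faces of a neighborly polytope at a vertex *)

Section Neighborly.
Variables (R : realType) (d r N : nat) (X : 'M[R]_(N, 2 * d)).
Hypothesis NE : N = (2 * d + 1 + r)%N.
Hypothesis nX : forall A : {set 'I_N}, #|A| = d -> face_set X A.

(* Otherwise a face contains the positive part of [w] but not all of its negative
   part, and [w] pairs to a negative number with its supporting affine form. *)
Lemma neighborly_pos (w : 'rV[R]_N) :
  w *m homogenize X = 0 -> w != 0 -> (d < #|pos w|)%N.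
Proof.
move=> wX w0; rewrite ltnNge; apply/negP => wd.
have [s ws] : exists s, w 0 s < 0.
  apply/existsP; apply: contraNT w0; rewrite negb_exists => /forallP w_ge.
  have w_ge0 i : 0 <= w 0 i by rewrite leNgt.
  move/eqP: (homogenize_sum wX); rewrite psumr_eq0 => [/allP w_eq|//].
  by apply/eqP/rowP => i; rewrite mxE; apply/eqP/w_eq; rewrite mem_index_enum.
have [A [wA As Ad]] : exists A : {set 'I_N},
    [/\ pos w \subset A, A \subset ~: [set s]%SET & #|A| = d].
  apply: subset_of_card; first by rewrite subsetC sub1set !inE -leNgt ltW.
  by rewrite wd cardsC1 card_ord; lia.
have /asboolP[a [b [Xb AE]]] := nX Ad.
have := homogenize_gap a b wX; apply/eqP; rewrite lt_eqF //.
have gap i : i \notin A = (0 < b - (X *m a) i 0).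
  by rewrite AE inE subr_gt0 lt_neqAle Xb andbT.
rewrite (bigD1 s) //= ltr_nwDl //.
  rewrite nmulr_rlt0 // -gap.
  by apply/negP => /(subsetP As); rewrite !inE eqxx.
apply: sumr_le0 => i _; have [|iA] := boolP (i \in A).
  by rewrite AE inE => /eqP ->; rewrite subrr mulr0.
rewrite mulr_le0_ge0 //; last by rewrite ltW // -gap.
by rewrite leNgt; apply: contra iA => wi; apply: (subsetP wA); rewrite inE.
Qed.

Lemma neighborly_neg (w : 'rV[R]_N) :
  w *m homogenize X = 0 -> w != 0 -> (d < #|pos (- w)|)%N.
Proof. by move=> wX w0; rewrite neighborly_pos ?oppr_eq0 // mulNmx wX oppr0. Qed.

(** At least [d + 1] positive and [d + 1] negative entries among [2 * d + 1 + r] leave at most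
    [r - 1] zeros. *)
Lemma neighborly_generic : generic (homogenize X) r.
Proof.
split=> // w wX w0; have := card_pos_neg_zer w [set: 'I_N]%SET.
rewrite !finset.setIT cardsT card_ord.
by have := neighborly_pos wX w0; have := neighborly_neg wX w0; lia.
Qed.

Lemma card_pointed_neighborly (i0 : 'I_N) (s : nat) : (0 < s)%N ->
  #|[set S : {set 'I_N} | [&& S \subset ~: [set i0],
       #|S| == s & pointed (homogenize X) S]]%SET|%:Z =
  pointed_number r d N.-1 s.
Proof.
move=> s0; have cE : #|~: [set i0]%SET| = N.-1 by rewrite cardsC1 card_ord.
rewrite (card_pointedE neighborly_generic _ _ s0 (d := d)) ?cE //; first by lia.
move=> w wX w0; have := card_pos_neg_zer w (~: [set i0]%SET).
(* Dropping [i0] costs at most one entry of each sign, so among the remaining [2 * d + r] entries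
   between [d] and [d + r] are positive. *)
have half (u : 'rV[R]_N) : (d < #|pos u|)%N -> (d <= #|pos u :&: ~: [set i0]%SET|)%N.
  by rewrite (cardsD1 i0 (pos u)) -setDE; case: (i0 \in _) => //=; exact: ltnW.
have := half _ (neighborly_pos wX w0); have := half _ (neighborly_neg wX w0).
by rewrite cE; lia.
Qed.

(** Complementation: proper face sets of size [t] through [i0] correspond to the non-pointed sets of
    size [N - t] avoiding [i0]. *)
Lemma card_face_sets (i0 : 'I_N) (t : nat) :
  #|[set Z : {set 'I_N} | [&& face_set X Z, i0 \in Z & #|Z| == t]]%SET| =
  face_number r (2 * d) t.
Proof.
rewrite /face_number -NE; have [->|tN] := eqVneq t N.
  rewrite -[RHS](cards1 [set: 'I_N]%SET); apply: eq_card => Z; rewrite !inE.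
  apply/and3P/eqP => [[_ _ /eqP ZN]|->].
    by apply/eqP; rewrite eqEcard subsetT cardsT card_ord ZN /=.
  by rewrite face_setT inE cardsT card_ord eqxx.
have [Nt|tN'] := ltnP N t.
  apply: eq_card0 => Z; rewrite !inE; apply/negbTE/and3P => -[_ _ /eqP Zt].
  by have := max_card Z; rewrite card_ord Zt leqNgt Nt.
have [s sE] : exists s, s = (N - t)%N by exists (N - t)%N.
rewrite -sE (_ : (2 * d)./2 = d); last by lia.
have s0 : (0 < s)%N by lia.
rewrite -(card_pointed_neighborly i0 s0).
pose D := [set S : {set 'I_N} | S \subset ~: [set i0] & #|S| == s]%SET.
have <- : #|D| = 'C(N.-1, s) by rewrite cards_draws cardsC1 card_ord.
rewrite -(cardsID [set S | pointed (homogenize X) S]%SET D).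
rewrite (_ : D :&: [set S | pointed (homogenize X) S]%SET = [set S : {set 'I_N} |
    [&& S \subset ~: [set i0], #|S| == s & pointed (homogenize X) S]]%SET); last first.
  by apply/setP => S; rewrite !inE andbA.
rewrite PoszD addrAC subrr add0r absz_nat -(card_imset _ (@setC_inj _)).
apply: eq_card => S; rewrite -[S]setCK mem_imset; last exact: setC_inj.
rewrite setCK !inE subsetC sub1set !inE.
have -> : (#|~: S| == t) = (#|S| == s).
  by have := cardsC S; rewrite card_ord; lia.
have [St|] := boolP (#|S| == s); last by rewrite !andbF.
rewrite (face_set_pointed neighborly_generic); last by rewrite -card_gt0 (eqP St).
by rewrite !andbT.
Qed.

End Neighborly.

Lemma faces_at_neighborly (R : realType) (d r : nat)
    (X : 'M[R]_(2 * d + 1 + r, 2 * d)) (i0 : 'I_(2 * d + 1 + r)) (t : nat) :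
  injective (fun i => row i X) ->
  (forall i, vertices (comb X setT) (row i X)) ->
  (forall A : {set 'I_(2 * d + 1 + r)}, #|A| = d -> face_set X A) ->
  faces_at (comb X setT) (row i0 X) t #= `I_(face_number r (2 * d) t).
Proof.
move=> injX vX nX; rewrite -(card_face_sets (erefl _) nX i0 t).
exact: card_faces_at.
Qed.

Lemma neighborly_face_set (R : realType) (d N : nat) (X : 'M[R]_(N, 2 * d)) (A : {set 'I_N}) :
  injective (fun i => row i X) ->
  vertices (comb X setT) = range (fun i => row i X) ->
  neighborly d (comb X setT) -> #|A| = d -> face_set X A.
Proof.
move=> injX vX nX Ad; pose S := [set row i X | i in [set` A]].
have SV : S `<=` vertices (comb X setT) by move=> _ [i _ <-]; rewrite vX; exists i.
have SC : S #= `I_d.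
  rewrite /S (card_eql (inj_card_eq _)); first exact/card_set_finset.
  by move=> i j _ _; exact: injX.
have [F [FX FS]] := nX S SV SC.
have [Z fZ FE] := (is_face_comb X F).1 FX.
suff -> : A = Z by [].
have : S = [set row i X | i in [set` Z]].
  by rewrite -FS FE vertices_comb // => i; rewrite vX; exists i.
move=> SE; apply/setP => i; apply/idP/idP => iA.
  have : S (row i X) by exists i.
  by rewrite SE => -[j jZ /injX <-].
have : [set row i X | i in [set` Z]] (row i X) by exists i.
by rewrite -SE => -[j jZ /injX <-].
Qed.

(** * Cyclic polytopes and the comparison *)

(** The square [q] of the polynomial with simple roots at the parameters of [A] has degree at most
    [2 * d], is nonnegative and vanishes exactly at those parameters; its coefficients give the
    supporting hyperplane. *)
Lemma moment_face_set (R : realType) (d N : nat) (t : 'I_N -> R) (A : {set 'I_N}) :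
  injective t -> (#|A| <= d)%N ->
  face_set (\matrix_i moment_curve (2 * d) (t i)) A.
Proof.
move=> injt Ad; set X := \matrix_i _.
pose q : {poly R} := (\prod_(i <- enum A) ('X - (t i)%:P)) ^+ 2.
have szq : (size q <= (2 * d).+1)%N.
  apply: leq_trans (size_poly_exp_leq _ _) _.
  by rewrite size_prod_XsubC -cardE; lia.
have qE i : (X *m - (\col_j q`_j.+1)) i 0 = q`_0 - q.[t i].
  rewrite (horner_coef_wide _ szq) big_ord_recl mulr1 opprD addrA subrr add0r.
  rewrite mulmxN !mxE; congr (- _); apply: eq_bigr => j _.
  by rewrite !mxE mulrC.
have q_horner i : q.[t i] = (\prod_(j in A) (t i - t j)) ^+ 2.
  rewrite horner_exp horner_prod big_enum; congr (_ ^+ 2).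
  by apply: eq_bigr => j _; rewrite !hornerE.
apply/asboolP; exists (- \col_j q`_j.+1), q`_0; split=> [i|].
  by rewrite qE gerBl q_horner sqr_ge0.
apply/setP => i; rewrite inE qE -subr_eq0 addrAC subrr add0r oppr_eq0 q_horner sqrf_eq0.
apply/idP/prodf_eq0 => [iA|[j jA]]; first by exists i; rewrite // subrr.
by rewrite subr_eq0 => /eqP/injt ->.
Qed.

(** The bound [#|A| <= d], rather than equality, also covers singletons, which shows that every
    point is a vertex. *)
Lemma cyclic_comb (R : realType) (d N : nat) (C : set 'rV[R]_(2 * d)) :
  (0 < d)%N -> is_cyclic_polytope N C ->
  exists X : 'M[R]_(N, 2 * d), [/\ C = comb X setT, injective (fun i => row i X) &
    forall A : {set 'I_N}, (#|A| <= d)%N -> face_set X A].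
Proof.
move=> d0 [t [injt CE]]; exists (\matrix_i moment_curve (2 * d) (t i)); split.
- rewrite CE -hull_comb.
  rewrite (_ : (fun i => row i _) = fun i => moment_curve (2 * d) (t i)) //.
  by apply/funext => i; rewrite rowK.
- move=> i j; rewrite !rowK => /rowP tE; apply: injt.
  have lt : (0 < 2 * d)%N by lia.
  by have := tE (Ordinal lt); rewrite !mxE !expr1.
- by move=> A; exact: moment_face_set.
Qed.

Theorem theorem1p16 (R : realType) :
  exists f : nat -> nat -> nat, forall d t : nat, (1 <= d)%N ->
    (forall (P : set 'rV[R]_(2 * d)) (v : 'rV[R]_(2 * d)),
        is_T_polytope d P -> vertices P v ->
        faces_at P v t #= `I_(f (2 * d)%N t)) /\
    (forall (C : set 'rV[R]_(2 * d)) (w : 'rV[R]_(2 * d)),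
        is_cyclic_polytope (2 * d + 4) C ->
        vertices C w ->
        faces_at C w t #= `I_(f (2 * d)%N t)).
Proof.
(* The dependences of [2 * d + 4] points spanning dimension [2 * d] form a space of dimension 3. *)
exists (face_number 3) => d t d1.
have NE : (2 * d + 4 = 2 * d + 1 + 3)%N by lia.
rewrite NE; split=> [P v [_ polP nP [x [injx vP _]]]|C w cC].
  rewrite NE in x injx vP *.
  pose X := \matrix_i x i.
  have rowX : (fun i => row i X) = x by apply/funext => i; rewrite rowK.
  have PE : P = comb X setT by apply: polytope_comb; rewrite // rowX.
  rewrite {}PE in nP vP *; rewrite vP => -[i _ <-].
  rewrite -[x i](rowK x); apply: faces_at_neighborly; rewrite ?rowX //.
    by move=> j; rewrite vP rowK; exists j.
  by move=> A; apply: neighborly_face_set; rewrite ?rowX.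
have [X [-> injX fX]] := cyclic_comb d1 cC.
have vX i : vertices (comb X setT) (row i X).
  apply/is_face_comb; exists [set i]%SET; first by apply: fX; rewrite cards1.
  apply/seteqP; split=> [_ ->|_ [l [_ l1 lZ ->]]].
    by apply: row_comb; rewrite inE.
  rewrite /= rowE; congr (_ *m _); apply/rowP => j; rewrite mxE eqxx /=.
  have li : l 0 i = 1.
    rewrite -l1 (bigD1 i) //= big1 ?addr0 // => k ki.
    by apply: lZ; rewrite inE.
  by case: eqVneq => [->//|ji]; apply: lZ; rewrite inE.
rewrite (vertices_comb vX (face_setT X)) => -[i _ <-].
by apply: faces_at_neighborly => // A Ad; apply: fX; rewrite Ad.
Qed.
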